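(* Let $(\mathscr{H},\mathscr{C})$ be a continuous field of Hilbert spaces over a topological space $X$. (1) If $(\zeta_\alpha)_{\alpha\in A}$ is a net in $\mathscr{H}$ with $\zeta_\alpha\xrightarrow{\mathsf{w}}\zeta_\infty$ and $\|\zeta_\alpha\|\to\|\zeta_\infty\|$, then $\zeta_\alpha\xrightarrow{\mathsf{s}}\zeta_\infty$. (2) If $\zeta_\infty\in\mathscr{H}$ and $(\zeta_\alpha)_{\alpha\in A}$ is a net in $\mathscr{H}$ with the property that for every meta weakly convergent net $(\xi_\alpha)_{\alpha\in A}$ (with meta weak limit $\xi_\infty\in\mathscr{H}_{\pi(\zeta_\infty)}$) satisfying $\pi(\zeta_\alpha)=\pi(\xi_\alpha)$ for all $\alpha\in A$ one has $\langle\zeta_\alpha,\xi_\alpha\rangle\to\langle\zeta_\infty,\xi_\infty\rangle$, then $\zeta_\alpha\xrightarrow{\mathsf{s}}\zeta_\infty$.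
   Context: Fix $\mathbb{K}\in\{\mathbb{R},\mathbb{C}\}$. A section of a family $\mathscr{H}=(\mathscr{H}_x)_{x\in X}$ of $\mathbb{K}$-Hilbert spaces is a map $f$ on $X$ with $f(x)\in\mathscr{H}_x$; $\Gamma(\mathscr{H})$ is the vector space of sections; $\mathscr{H}$ is also identified with $\bigsqcup_x\mathscr{H}_x$ with projection $\pi:\mathscr{H}\to X$. $(\mathscr{H},\mathscr{C})$ is a continuous field of Hilbert spaces if $\mathscr{C}\subset\Gamma(\mathscr{H})$ is a linear subspace such that: (a) $x\mapsto\|f(x)\|$ is continuous for all $f\in\mathscr{C}$; (b) every $g\in\Gamma(\mathscr{H})$ such that for all $x\in X,\varepsilon>0$ there are $f\in\mathscr{C}$ and a neighborhood $U$ of $x$ with $\|g(y)-f(y)\|\le\varepsilon$ for all $y\in U$ belongs to $\mathscr{C}$; (c) for all $x\in X,\zeta\in\mathscr{H}_x$ there is $f\in\mathscr{C}$ with $f(x)=\zeta$. Strong topology on $\mathscr{H}$: base $\{\zeta\in\mathscr{H}:\pi(\zeta)\in V,\ \|\zeta-f(\pi(\zeta))\|<\varepsilon\}$, $V\subset X$ open, $f\in\mathscr{C}$, $\varepsilon>0$; convergence is written $\xrightarrow{\mathsf{s}}$. Weak topology on $\mathscr{H}$: let $\mathscr{C}^{\mathsf{s}}(\mathscr{H},X\times\mathbb{K})$ be the set of all families $u=(u(x))_{x\in X}$ of continuous linear functionals $u(x):\mathscr{H}_x\to\mathbb{K}$ such that $x\mapsto u(x)(f(x))$ is continuous for all $f\in\mathscr{C}$,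 and put $\mathscr{C}^{\mathsf{w}}=\{g\in\Gamma(\mathscr{H}):x\mapsto u(x)(g(x))\text{ is continuous for all }u\in\mathscr{C}^{\mathsf{s}}(\mathscr{H},X\times\mathbb{K})\}$; a base is given by the sets $\{\zeta\in\mathscr{H}:\pi(\zeta)\in V,\ \max_{u\in F}|u(\pi(\zeta))(\zeta-g(\pi(\zeta)))|<\varepsilon\}$, $V\subset X$ open, $g\in\mathscr{C}^{\mathsf{w}}$, $F\subset\mathscr{C}^{\mathsf{s}}(\mathscr{H},X\times\mathbb{K})$ non-empty finite, $\varepsilon>0$; convergence is written $\xrightarrow{\mathsf{w}}$. A net $(\xi_\alpha)_{\alpha\in A}$ in $\mathscr{H}$ converges meta weakly to $\xi_\infty\in\mathscr{H}$ if for every net $(\eta_\alpha)_{\alpha\in A}$ in $\mathscr{H}$ with $\pi(\eta_\alpha)=\pi(\xi_\alpha)$ for all $\alpha\in A$ (and $\eta_\infty\in\mathscr{H}_{\pi(\xi_\infty)}$), $\eta_\alpha\xrightarrow{\mathsf{s}}\eta_\infty$ implies $\langle\xi_\alpha,\eta_\alpha\rangle\to\langle\xi_\infty,\eta_\infty\rangle$.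
   Formalization: In (2), when ζ_∞ = 0 it is additionally assumed that π(ζ_α) → π(ζ_∞); without this the claim fails (X = {x,y} discrete, ζ_α = 0_x, ζ_∞ = 0_y), and strong convergence always implies it. *)

(* Defs.v *)
From HB Require Import structures.
From mathcomp Require Import all_boot all_order all_algebra.
From mathcomp Require Import sesquilinear complex.
From mathcomp Require Import all_classical all_reals all_analysis.

Set Implicit Arguments.
Unset Strict Implicit.
Unset Printing Implicit Defensive.

Import Order.TTheory GRing.Theory Num.Theory.
Import numFieldNormedType.Exports.

Local Open Scope classical_set_scope.
Local Open Scope ring_scope.

Variant scalar_kind := RealScalars | ComplexScalars.

Definition scalarField (R : realType) (k : scalar_kind) : numFieldType :=
  match k with RealScalars => R | ComplexScalars => R[i] end.

Definition scalar_conj (R : realType) (k : scalar_kind) :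
    scalarField R k -> scalarField R k :=
  match k with RealScalars => idfun | ComplexScalars => @conjc R end.

Arguments scalar_conj : clear implicits.

(* The norm takes its values in [scalarField R k], as for every normedModType;
   in the complex case these values are nonnegative reals.  The library's
   [{dot H for theta}] is linear in its first argument and theta-linear in its
   second one. *)
HB.mixin Record CompleteNormedModule_isHilbert (R : realType) (k : scalar_kind)
    H & CompleteNormedModule (scalarField R k) H := {
  dotp : {dot H for scalar_conj R k};
  dotp_norm : forall x : H, dotp x x = `|x| ^+ 2
}.

#[short(type="hilbertType")]
HB.structure Definition Hilbert (R : realType) (k : scalar_kind) :=
  {H of CompleteNormedModule (scalarField R k) H
      & CompleteNormedModule_isHilbert R k H}.

Record continuous_field (R : realType) (k : scalar_kind)
    (X : topologicalType) := ContinuousField {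
  fiber : X -> hilbertType R k;
  csection : set (forall x, fiber x);
  csection0 : csection (fun=> 0);
  csectionP : forall (a : scalarField R k) (f g : forall x, fiber x),
    csection f -> csection g -> csection (fun x => a *: f x + g x);
  csection_norm : forall f : forall x, fiber x,
    csection f -> continuous (fun x => `|f x|);
  csection_local : forall g : forall x, fiber x,
    (forall (x : X) (e : scalarField R k), 0 < e ->
       exists2 f, csection f & \forall y \near x, `|g y - f y| <= e) ->
    csection g;
  csection_full : forall (x : X) (z : fiber x),
    exists2 f, csection f & f x = z
}.

Arguments csection {R k X} c _.

Definition bundle (R : realType) (k : scalar_kind) (X : topologicalType)
  (H : continuous_field R k X) := {x : X & fiber H x}.

Definition bproj (R : realType) (k : scalar_kind) (X : topologicalType)
  (H : continuous_field R k X) (z : bundle H) : X := projT1 z.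

Definition bvect (R : realType) (k : scalar_kind) (X : topologicalType)
  (H : continuous_field R k X) (z : bundle H) : fiber H (bproj z) := projT2 z.

Definition bpoint (R : realType) (k : scalar_kind) (X : topologicalType)
  (H : continuous_field R k X) (x : X) (v : fiber H x) : bundle H :=
  existT _ x v.

Section Topologies.
Context {R : realType} {k : scalar_kind} {X : topologicalType}.
Variable H : continuous_field R k X.
Local Notation K := (scalarField R k).
Implicit Types (f g : forall x, fiber H x) (z : bundle H) (V : set X) (e : K).

Definition strong_base : set (set (bundle H)) :=
  [set B | exists V f e, [/\ open V, csection H f, 0 < e &
    B = [set z | V (bproj z) /\ `|bvect z - f (bproj z)| < e]]].

Definition cfunctional : set (forall x, {scalar fiber H x}) :=
  [set u | (forall x, continuous (u x : fiber H x -> K)) /\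
    forall f, csection H f -> continuous (fun x => u x (f x) : K)].

Definition wsection : set (forall x, fiber H x) :=
  [set g | forall u, cfunctional u -> continuous (fun x => u x (g x) : K)].

(* [max_{u in F} |u _| < e] is spelled out over the nonempty finite set [F]. *)
Definition weak_base : set (set (bundle H)) :=
  [set B | exists V g (F : set (forall x, {scalar fiber H x})) e,
    [/\ open V, wsection g, [/\ F `<=` cfunctional, finite_set F & F !=set0],
        0 < e &
        B = [set z | V (bproj z) /\
               forall u, F u -> `|u (bproj z) (bvect z - g (bproj z))| < e]]].

Lemma csection_wsection f : csection H f -> wsection f.
Proof. by move=> Cf u [_ +]; exact. Qed.

Lemma csectionB f g :
  csection H f -> csection H g -> csection H (fun x => f x - g x).
Proof.
move=> Cf Cg; have := csectionP (-1) Cg Cf; congr csection.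
by apply/functional_extensionality_dep => x; rewrite scaleN1r addrC.
Qed.

Lemma cfunctional0 : cfunctional (fun x => \0 : {scalar fiber H x}).
Proof. by split=> [x|f _] y; exact: cst_continuous. Qed.

Lemma common_radius (e1 e2 : K) : 0 < e1 -> 0 < e2 ->
  exists2 e : K, 0 < e & e <= e1 /\ e <= e2.
Proof.
move=> e10 e20; case/orP: (real_leVge (gtr0_real e10) (gtr0_real e20)) => e12.
- by exists e1.
- by exists e2.
Qed.

Lemma open_normlt (h : X -> K) (c : K) : continuous h ->
  open [set x | `|h x| < c].
Proof.
move=> ch; rewrite (_ : [set x | _] = h @^-1` ball (0 : K^o) c).
  by apply: (@open_comp X K^o) => [x _|]; [exact: ch|exact: ball_open].
by apply/seteqP; split=> x; rewrite -ball_normE /ball_ /= sub0r normrN.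
Qed.

Lemma strong_base_refine (B : set (bundle H)) z f : strong_base B -> B z ->
  csection H f -> f (bproj z) = bvect z ->
  exists2 e : K, 0 < e & \forall y \near bproj z, forall w : fiber H y,
    `|w - f y| < e -> B (bpoint w).
Proof.
move=> [V [g [c [oV Cg c0 ->]]]] [Vz zg] Cf fz.
pose e := (c - `|bvect z - g (bproj z)|) / 2.
have e0 : 0 < e by rewrite divr_gt0 // subr_gt0.
have ce : `| `|f (bproj z) - g (bproj z)| | < c - e.
  rewrite normr_id fz ltrBrDr -ltrBrDl /e.
  by rewrite ltr_pdivrMr // mulr_natr mulr2n ltrDl subr_gt0.
exists e => //.
have oU := open_normlt (c - e) (csection_norm (csectionB Cf Cg)).
have := open_nbhs_nbhs (conj oU ce : open_nbhs (bproj z) _).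
have := open_nbhs_nbhs (conj oV Vz : open_nbhs (bproj z) V).
apply: filterS2 => y Vy /=; rewrite normr_id => fg w wf; split=> //.
rewrite /bvect /bproj /= -[w](subrK (f y)) -addrA.
apply: le_lt_trans (ler_normD _ _) _.
by apply: lt_le_trans (ltrD wf fg) _; rewrite addrC subrK.
Qed.

Lemma strong_base_cover : \bigcup_(B in strong_base) id B = setT.
Proof.
apply/seteqP; split=> // -[x v] _.
have [f Cf fx] := csection_full v.
exists [set z | setT (bproj z) /\ `|bvect z - f (bproj z)| < 1].
  by exists setT, f, 1; split=> //; exact: openT.
by split=> //=; rewrite /bvect /= fx subrr normr0.
Qed.

Lemma strong_base_join B1 B2 z : strong_base B1 -> strong_base B2 ->
  B1 z -> B2 z ->
  exists B, [/\ strong_base B, B z & B `<=` B1 `&` B2].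
Proof.
move=> sB1 sB2 B1z B2z; have [f Cf fz] := csection_full (bvect z).
have [e1 e10 near1] := strong_base_refine sB1 B1z Cf fz.
have [e2 e20 near2] := strong_base_refine sB2 B2z Cf fz.
have [e e0 [ee1 ee2]] := common_radius e10 e20.
have := @filterI _ _ (nbhs_filter (bproj z)) _ _ near1 near2.
rewrite nbhsE => -[V [oV Vz] VB].
exists [set z | V (bproj z) /\ `|bvect z - f (bproj z)| < e]; split.
- by exists V, f, e.
- by split=> //; rewrite fz subrr normr0.
- move=> [y w] [/= /VB[/= yB1 yB2] we].
  by split; [apply: yB1|apply: yB2]; exact: lt_le_trans we _.
Qed.

Lemma finite_radius (T : Type) (F : set T) (x : X)
    (P : T -> K -> X -> Prop) : finite_set F ->
  (forall u (e e' : K) y, e' <= e -> P u e y -> P u e' y) ->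
  (forall u, F u -> exists2 e : K, 0 < e & \forall y \near x, P u e y) ->
  exists2 e : K, 0 < e & \forall y \near x, forall u, F u -> P u e y.
Proof.
move=> /(@finite_seqP {classic T})[s ->] Ple.
elim: s => [_|u s IH uP]; first by exists 1 => //; apply: nearW.
have [|e1 e10 P1] := IH; first by move=> v vs; apply: uP; rewrite /= inE vs orbT.
have [|e2 e20 P2] := uP u; first by rewrite /= inE eqxx.
have [e e0 [ee1 ee2]] := common_radius e10 e20.
exists e => //; apply: filterS2 P1 P2 => y Py1 Py2 v /=.
rewrite inE => /orP[/eqP->|vs]; first exact: Ple ee2 Py2.
by apply: Ple ee1 _; exact: Py1.
Qed.

Lemma weak_base_refine (B : set (bundle H)) z f : weak_base B -> B z ->
  csection H f -> f (bproj z) = bvect z ->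
  exists F : set (forall x, {scalar fiber H x}),
    [/\ F `<=` cfunctional, finite_set F, F !=set0 &
    exists2 e : K, 0 < e & \forall y \near bproj z, forall w : fiber H y,
      (forall u, F u -> `|u y (w - f y)| < e) -> B (bpoint w)].
Proof.
move=> [V [g [F [c [oV wg [FC finF F0] c0 ->]]]]] [Vz zg] Cf fz.
exists F; split=> //.
pose P (u : forall x, {scalar fiber H x}) (e : K) (y : X) :=
  forall w : fiber H y, `|u y (w - f y)| < e -> `|u y (w - g y)| < c.
have [|u Fu|e e0 eP] := @finite_radius _ F (bproj z) P finF.
- by move=> u e e' y e'e Pe w wf; apply: Pe; exact: lt_le_trans e'e.
- pose e := (c - `|u (bproj z) (bvect z - g (bproj z))|) / 2.
  have e0 : 0 < e by rewrite divr_gt0 // subr_gt0; exact: zg.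
  have ce : `|u (bproj z) (f (bproj z)) - u (bproj z) (g (bproj z))| < c - e.
    rewrite -linearB fz ltrBrDr -ltrBrDl /e.
    by rewrite ltr_pdivrMr // mulr_natr mulr2n ltrDl subr_gt0; exact: zg.
  exists e => //.
  have cu : continuous (fun x => u x (f x) - u x (g x) : K).
    move=> y; apply: (@cvgB K K^o).
      exact: (csection_wsection Cf (FC _ Fu)).
    exact: (wg _ (FC _ Fu)).
  have oU := open_normlt (c - e) cu.
  have := open_nbhs_nbhs (conj oU ce : open_nbhs (bproj z) _).
  apply: filterS => y /= fg w wf.
  rewrite -[w](subrK (f y)) -addrA linearD.
  apply: le_lt_trans (ler_normD _ _) _; rewrite -linearB in fg.
  by apply: lt_le_trans (ltrD wf fg) _; rewrite addrC subrK.
- exists e => //.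
  have := open_nbhs_nbhs (conj oV Vz : open_nbhs (bproj z) V).
  apply: filterS2 eP => y yP Vy w wf; split=> // u Fu.
  by apply: (yP u Fu); exact: wf.
Qed.

Lemma weak_base_cover : \bigcup_(B in weak_base) id B = setT.
Proof.
apply/seteqP; split=> // -[x v] _.
have [f Cf fx] := csection_full v.
pose u0 (x : X) : {scalar fiber H x} := \0.
exists [set z | setT (bproj z) /\
  forall u, [set u0] u -> `|u (bproj z) (bvect z - f (bproj z))| < 1].
  exists setT, f, [set u0], 1; split=> //; [exact: openT|exact: csection_wsection|].
  by split=> [_ ->||]; [exact: cfunctional0|exact: finite_set1|exists u0].
by split=> // _ ->; rewrite /= normr0.
Qed.

Lemma weak_base_join B1 B2 z : weak_base B1 -> weak_base B2 ->
  B1 z -> B2 z ->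
  exists B, [/\ weak_base B, B z & B `<=` B1 `&` B2].
Proof.
move=> sB1 sB2 B1z B2z; have [f Cf fz] := csection_full (bvect z).
have [F1 [F1C F1fin F10 [e1 e10 near1]]] := weak_base_refine sB1 B1z Cf fz.
have [F2 [F2C F2fin F20 [e2 e20 near2]]] := weak_base_refine sB2 B2z Cf fz.
have [e e0 [ee1 ee2]] := common_radius e10 e20.
have := @filterI _ _ (nbhs_filter (bproj z)) _ _ near1 near2.
rewrite nbhsE => -[V [oV Vz] VB].
exists [set z | V (bproj z) /\
  forall u, (F1 `|` F2) u -> `|u (bproj z) (bvect z - f (bproj z))| < e]; split.
- exists V, f, (F1 `|` F2), e; split=> //; first exact: csection_wsection.
  split; [by rewrite subUset|by rewrite finite_setU|].
  by have [u F1u] := F10; exists u; left.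
- by split=> // u _; rewrite fz subrr linear0 normr0.
- move=> [y w] [/= /VB[/= yB1 yB2] we].
  split; [apply: yB1|apply: yB2] => u Fu.
    by apply: lt_le_trans (we u _) ee1; left.
  by apply: lt_le_trans (we u _) ee2; right.
Qed.

End Topologies.

(* Two copies of the bundle, kept apart because [{x & _}] already carries
   the disjoint-union topology. *)
Definition strong_space (R : realType) (k : scalar_kind) (X : topologicalType)
  (H : continuous_field R k X) := bundle H.

Definition weak_space (R : realType) (k : scalar_kind) (X : topologicalType)
  (H : continuous_field R k X) := bundle H.

Section Instances.
Context {R : realType} {k : scalar_kind} {X : topologicalType}.
Variable H : continuous_field R k X.

HB.instance Definition _ := Choice.on (strong_space H).
HB.instance Definition _ := isBaseTopological.Build (strong_space H)
  (strong_base_cover H) (@strong_base_join _ _ _ H).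

HB.instance Definition _ := Choice.on (weak_space H).
HB.instance Definition _ := isBaseTopological.Build (weak_space H)
  (weak_base_cover H) (@weak_base_join _ _ _ H).

End Instances.

Definition directed (A : Type) (le : A -> A -> Prop) :=
  [/\ exists a : A, True, (forall a, le a a),
      (forall a b c, le a b -> le b c -> le a c) &
      (forall a b, exists2 c, le a c & le b c)].

(* The filter of final segments of the index set: the net [s] converges to [l]
   when [s @ tails le --> l]. *)
Definition tails (A : Type) (le : A -> A -> Prop) : set_system A :=
  filter_from setT (fun a => [set b | le a b]).

Section Convergence.
Context {R : realType} {k : scalar_kind} {X : topologicalType}.
Context {H : continuous_field R k X} {A : Type}.
Implicit Types (le : A -> A -> Prop) (s : A -> bundle H) (l : bundle H).

Definition strong_cvg le s l :=
  (s : A -> strong_space H) @ tails le --> (l : strong_space H).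

Definition weak_cvg le s l :=
  (s : A -> weak_space H) @ tails le --> (l : weak_space H).

(* The nets [eta] with [bproj (eta a) = bproj (xi a)] are the sections of the
   fibers over [bproj \o xi]. *)
Definition meta_weak_cvg le (xi : A -> bundle H) (xi_oo : bundle H) :=
  forall (eta : forall a, fiber H (bproj (xi a)))
         (eta_oo : fiber H (bproj xi_oo)),
    strong_cvg le (fun a => bpoint (eta a)) (bpoint eta_oo) ->
    (fun a => dotp (bvect (xi a)) (eta a) : scalarField R k) @ tails le -->
      (dotp (bvect xi_oo) eta_oo : scalarField R k).

End Convergence.

(* Main.v *)
Require Import Defs.
From HB Require Import structures.
From mathcomp Require Import all_boot all_order all_algebra.
From mathcomp Require Import all_classical all_reals all_analysis.
From mathcomp Require Import complex.
From mathcomp Require Import ring.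

(* If [f] is a section in [C] through [zeta_oo], then [zeta_a -> zeta_oo]
   strongly iff the base points converge and
   [|zeta_a - f|^2 = |zeta_a|^2 + |f|^2 - <zeta_a, f> - <f, zeta_a>] tends to 0.
   In (1), [<., f>] belongs to the family of functionals defining the weak
   topology, so [<zeta_a, f> -> |zeta_oo|^2].  In (2), strongly convergent nets
   converge meta weakly, so the hypothesis says first that [zeta] itself
   converges meta weakly, and then, for [xi = zeta], that
   [|zeta_a|^2 -> |zeta_oo|^2].  Polarization reduces every continuity property
   of the inner product to one of the norm. *)

Set Implicit Arguments.
Unset Strict Implicit.
Unset Printing Implicit Defensive.

Import Order.TTheory GRing.Theory Num.Theory.
Import numFieldNormedType.Exports.

Local Open Scope classical_set_scope.
Local Open Scope ring_scope.

Lemma scalar_conjB (R : realType) (k : scalar_kind) :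
  {morph scalar_conj R k : a b / a - b}.
Proof. by case: k => a b //=; rewrite rmorphB. Qed.

Lemma norm_scalar_conj (R : realType) (k : scalar_kind) (a : scalarField R k) :
  `|scalar_conj R k a| = `|a|.
Proof. by case: k a => a //=; rewrite normcJ. Qed.

Lemma mul_scalar_conj (R : realType) (k : scalar_kind) (a : scalarField R k) :
  a * scalar_conj R k a = `|a| ^+ 2.
Proof.
case: k a => a /=; last by rewrite sqr_normc.
by rewrite real_normK ?num_real.
Qed.

(** * The inner product of a single fiber *)

Section InnerProduct.
Context {R : realType} {k : scalar_kind} {V : hilbertType R k}.
Local Notation K := (scalarField R k).
Local Notation conj := (scalar_conj R k).
Implicit Types (x y : V) (c : K).

Lemma dotpC x y : dotp x y = conj (dotp y x).
Proof. by rewrite sesquilinear.hermitian_subproof expr0 mul1r. Qed.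

Lemma dotpZl c x y : dotp (c *: x) y = c * dotp x y.
Proof. exact: sesquilinear.linearl_subproof. Qed.

Lemma dotpZr c x y : dotp x (c *: y) = conj c * dotp x y.
Proof. exact: sesquilinear.linearr_subproof. Qed.

Lemma sqr_normD x y : `|x + y| ^+ 2 =
  `|x| ^+ 2 + `|y| ^+ 2 + (dotp x y + dotp y x).
Proof.
rewrite -!dotp_norm sesquilinear.linearDl !sesquilinear.linearDr.
by rewrite [dotp y x + _]addrC addrACA.
Qed.

Lemma sqr_normB x y : `|x - y| ^+ 2 =
  `|x| ^+ 2 + `|y| ^+ 2 - (dotp x y + dotp y x).
Proof.
by rewrite sqr_normD normrN sesquilinear.linearNl sesquilinear.linearNr opprD.
Qed.

(** The arguments are swapped because [dotp] is linear in its first one: the partial application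
    [dotpr y] is the linear functional [<., y>]. *)
Definition dotpr y x : K := dotp x y.

Lemma dotpr_is_scalar y : scalar (dotpr y).
Proof. by move=> c u v; rewrite /dotpr sesquilinear.linearPl. Qed.

HB.instance Definition _ y :=
  @GRing.isLinear.Build K V K *%R (dotpr y) (dotpr_is_scalar y).

End InnerProduct.

(* The roots [c] are 1, -1 in the real case and the fourth roots of unity in the
   complex case. *)
Lemma polarization (R : realType) (k : scalar_kind) :
  exists s : seq (scalarField R k), forall (V : hilbertType R k) (x y : V),
    dotp x y *+ 4 = \sum_(c <- s) c * `|x + c *: y| ^+ 2.
Proof.
(* Since [c * conj c = 1], each root contributes [dotp x y] once. The roots sum to 0; their squares
   sum to 0 in the complex case, while in the real case [c ^+ 2 = 1] and [dotp] is symmetric. *)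
have E (V : hilbertType R k) (x y : V) c : `|c| = 1 -> c * `|x + c *: y| ^+ 2 =
    c * (`|x| ^+ 2 + `|y| ^+ 2) + dotp x y + c ^+ 2 * dotp y x.
  move=> c1; rewrite sqr_normD normrZ c1 mul1r dotpZr dotpZl.
  rewrite mulrDr (mulrDr c (_ * dotp x y)) mulrA mul_scalar_conj c1.
  by rewrite expr1n mul1r mulrA -expr2 addrA.
case: k E => /= E.
- exists [:: 1; -1] => V x y.
  rewrite !big_cons big_nil !E ?normrN ?normr1 //.
  by rewrite [dotp y x]dotpC /=; ring.
- have [i i1 i2] : exists2 i : R[i], `|i| = 1 & i ^+ 2 = -1.
    by exists 'i; [exact: normCi|exact: sqrCi].
  exists [:: 1; i; -1; -i] => V x y.
  rewrite !big_cons big_nil !E ?normrN ?normr1 ?i1 // !sqrrN i2.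
  by ring.
Qed.

(** The spaces [V t] vary with [t], so continuity of an inner product on one fixed space does not
    apply; [polarization] leaves only a finite sum of squared norms. *)
Lemma cvg_dotp (R : realType) (k : scalar_kind) (T : Type) (F : set_system T)
    (FF : Filter F) (V : T -> hilbertType R k) (W : hilbertType R k)
    (x y : forall t, V t) (x0 y0 : W) :
  (forall c, (fun t => `|x t + c *: y t| : scalarField R k) @ F -->
    (`|x0 + c *: y0| : scalarField R k)) ->
  (fun t => dotp (x t) (y t) : scalarField R k) @ F -->
    (dotp x0 y0 : scalarField R k).
Proof.
move=> xy; have [s sE] := polarization R k.
have E (U : hilbertType R k) (u v : U) :
    dotp u v = (\sum_(c <- s) c * `|u + c *: v| ^+ 2) / 4.
  by rewrite -sE -[dotp u v *+ 4]mulr_natr mulfK ?pnatr_eq0.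
rewrite E; under eq_fun do rewrite E.
apply: cvgM (cvg_cst _); elim: s {sE E} => [|c s IHs].
  by rewrite big_nil; under eq_fun do rewrite big_nil; exact: cvg_cst.
rewrite big_cons; under eq_fun do rewrite big_cons.
by apply: cvgD IHs; apply: cvgM (cvg_cst _) _; exact: cvgM.
Qed.

(** * Neighborhoods in the bundle and continuity along sections *)

Section Bundle.
Context {R : realType} {k : scalar_kind} {X : topologicalType}.
Variable H : continuous_field R k X.
Local Notation K := (scalarField R k).
Implicit Types (f g : forall x, fiber H x).

Lemma nbhs_strong (l : bundle H) (B : set (bundle H)) :
  strong_base B -> B l -> nbhs (l : strong_space H) B.
Proof.
move=> sB Bl; apply: open_nbhs_nbhs; split => //.
exists [set B]; first by move=> _ ->.
by rewrite bigcup_set1.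
Qed.

Lemma nbhs_weak (l : bundle H) (B : set (bundle H)) :
  weak_base B -> B l -> nbhs (l : weak_space H) B.
Proof.
move=> sB Bl; apply: open_nbhs_nbhs; split => //.
exists [set B]; first by move=> _ ->.
by rewrite bigcup_set1.
Qed.

Lemma nbhs_strongE (l : bundle H) (B : set (bundle H)) :
  nbhs (l : strong_space H) B ->
  exists B', [/\ strong_base B', B' l & B' `<=` B].
Proof.
rewrite nbhsE => -[U [[D sD <-] [B' DB' B'l]] UB].
by exists B'; split=> //; [exact: sD|move=> z B'z; apply: UB; exists B'].
Qed.

Lemma cvg_continuous_comp (T : Type) (F : set_system T) (p : T -> X) (x : X)
    (h : X -> K) :
  continuous h -> p @ F --> x -> (fun t => h (p t)) @ F --> h x.
Proof. by move=> ch px; exact: (cvg_comp p h px (ch x)). Qed.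

Lemma continuous_dotp f g : csection H f -> csection H g ->
  continuous (fun x => dotp (f x) (g x) : K).
Proof.
move=> Cf Cg x; apply: cvg_dotp => c.
have -> : (fun y => `|f y + c *: g y|) = (fun y => `|c *: g y + f y|).
  by apply/funext => y; rewrite addrC.
by rewrite addrC; exact: (csection_norm (csectionP c Cg Cf)).
Qed.

Lemma cfunctional_dotp f : csection H f ->
  cfunctional (fun x => dotpr (f x) : {scalar fiber H x}).
Proof.
move=> Cf; split=> [x v|g Cg]; last exact: continuous_dotp.
(* Here the family of spaces is constant, and continuity of the norm suffices. *)
apply: cvg_dotp => c; apply: cvg_norm; apply: cvgD => //; exact: cvg_cst.
Qed.

(** * Strong convergence of nets *)

Section Nets.
Context {A : Type} (le : A -> A -> Prop) (dirA : directed le).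

Instance tails_proper : ProperFilter (tails le).
Proof.
case: dirA => -[a0 _] lexx letr leub.
apply: filter_from_proper => [|a _]; last by exists a; exact: lexx.
apply: filter_from_filter => [|a b _ _]; first by exists a0.
have [c ac bc] := leub a b.
by exists c => // d cd; split; [exact: letr ac cd|exact: letr bc cd].
Qed.

(** By [strong_base_refine], each basic neighborhood of [l] contains a tube around [f] over a
    neighborhood of [bproj l], so one section through [l] tests strong convergence. *)
Lemma strong_cvgP f (z : A -> bundle H) (l : bundle H) :
  csection H f -> f (bproj l) = bvect l ->
  strong_cvg le z l <->
  (fun a => bproj (z a)) @ tails le --> bproj l /\
  (fun a => `|bvect (z a) - f (bproj (z a))| : K) @ tails le --> (0 : K).
Proof.
move=> Cf fl; split=> [zl|[pl nl] B /nbhs_strongE[B' [sB' B'l sub]]].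
  have near V (e : K) : open V -> V (bproj l) -> 0 < e ->
      \forall a \near tails le,
        V (bproj (z a)) /\ `|bvect (z a) - f (bproj (z a))| < e.
    move=> oV Vl e0.
    apply: (zl [set y | V (bproj y) /\ `|bvect y - f (bproj y)| < e]).
    apply: nbhs_strong; first by exists V, f, e.
    by split=> //; rewrite fl subrr normr0.
  split=> [B|].
    rewrite nbhsE => -[V [oV Vl] VB].
    by apply: filterS (near V 1 oV Vl ltr01) => a [/VB].
  apply/cvgr0Pnorm_lt => e e0.
  by apply: filterS (near setT e openT I e0) => a [_]; rewrite normr_id.
have [e e0 eB] := strong_base_refine sB' B'l Cf fl.
have /cvgr0Pnorm_lt/(_ e e0) := nl.
move=> near_e.
suff : \forall a \near tails le, B' (z a) by apply: filterS => a /sub.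
have near_B : \forall a \near tails le, forall w : fiber H (bproj (z a)),
    `|w - f (bproj (z a))| < e -> B' (bpoint w) := pl _ eB.
apply: filterS2 near_B near_e => a.
(* Destructing [z a] identifies it with the [bpoint] of its own vector. *)
by rewrite normr_id; case: (z a) => x v /= zB; exact: zB.
Qed.

(** For a section [f] through [l], the norms of [z a] and of [f] at the same base point differ by at
    most [|z a - f|], and the norm of [f] is continuous. *)
Lemma strong_cvg_norm (z : A -> bundle H) (l : bundle H) : strong_cvg le z l ->
  (fun a => `|bvect (z a)| : K) @ tails le --> (`|bvect l| : K).
Proof.
have [f Cf fl] := csection_full (bvect l).
move=> /(strong_cvgP _ Cf fl)[pl nl].
have fz : (fun a => `|f (bproj (z a))| : K) @ tails le --> (`|bvect l| : K).
  by rewrite -fl; exact: (cvg_continuous_comp (csection_norm Cf) pl).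
apply/cvgrPdist_lt => e e0.
have e20 : 0 < e / 2 by rewrite divr_gt0.
have /cvgrPdist_lt/(_ _ e20) := fz; have /cvgr0Pnorm_lt/(_ _ e20) := nl.
apply: filterS2 => a; rewrite normr_id => h1 h2.
rewrite [e]splitr (le_lt_trans (ler_distD `|f (bproj (z a))| _ _))//.
by rewrite ltrD// (le_lt_trans _ h1)// distrC ler_dist_dist.
Qed.

(** Both nets lie over [p], so they can be added fiberwise; the test section is [c *: g + f], with
    [f] and [g] through the two limits. *)
Lemma strong_cvgDZ (p : A -> X) (p_oo : X) (x y : forall a, fiber H (p a))
    (x_oo y_oo : fiber H p_oo) (c : K) :
  strong_cvg le (fun a => bpoint (x a)) (bpoint x_oo) ->
  strong_cvg le (fun a => bpoint (y a)) (bpoint y_oo) ->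
  strong_cvg le (fun a => bpoint (x a + c *: y a)) (bpoint (x_oo + c *: y_oo)).
Proof.
have [f Cf fl] := csection_full (bvect (bpoint x_oo)).
have [g Cg gl] := csection_full (bvect (bpoint y_oo)).
move=> /(strong_cvgP _ Cf fl)[pl xl] /(strong_cvgP _ Cg gl)[_ yl].
have Cfg := csectionP c Cg Cf.
apply/(strong_cvgP _ Cfg); first by rewrite /= fl gl addrC.
split=> //=; apply/cvgr0Pnorm_lt => e e0.
have h : (fun a => `|x a - f (p a)| + `|c| * `|y a - g (p a)| : K) @ tails le
    --> (0 : K).
  rewrite -[0](addr0 0) -[in X in _ + X](mulr0 `|c|).
  by apply: cvgD xl _; exact: cvgM (cvg_cst _) yl.
have /cvgr0Pnorm_lt/(_ e e0) := h.
apply: filterS => a; rewrite normr_id; apply: le_lt_trans.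
rewrite ger0_norm ?addr_ge0 ?mulr_ge0// -normrZ /bvect /=.
rewrite [_ *: _ + f _]addrC opprD addrACA -scalerBr.
exact: ler_normD.
Qed.

Lemma strong_meta_weak_cvg (p : A -> X) (p_oo : X)
    (x : forall a, fiber H (p a)) (x_oo : fiber H p_oo) :
  strong_cvg le (fun a => bpoint (x a)) (bpoint x_oo) ->
  meta_weak_cvg le (fun a => bpoint (x a)) (bpoint x_oo).
Proof.
move=> xl y y_oo yl; apply: cvg_dotp => c.
exact: (strong_cvg_norm (strong_cvgDZ xl yl)).
Qed.

Lemma strong_cvg_dotp f (z : A -> bundle H) (l : bundle H) :
  csection H f -> f (bproj l) = bvect l ->
  (fun a => bproj (z a)) @ tails le --> bproj l ->
  (fun a => `|bvect (z a)| ^+ 2 : K) @ tails le --> (`|bvect l| ^+ 2 : K) ->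
  (fun a => dotp (bvect (z a)) (f (bproj (z a))) : K) @ tails le -->
    (dotp (bvect l) (bvect l) : K) ->
  strong_cvg le z l.
Proof.
move=> Cf fl pl nl dl; apply/(strong_cvgP _ Cf fl); split=> //.
have fz : (fun a => `|f (bproj (z a))| : K) @ tails le --> (`|bvect l| : K).
  by rewrite -fl; exact: (cvg_continuous_comp (csection_norm Cf) pl).
(* Conjugation is isometric, so the swapped pairing converges too. *)
have dl' : (fun a => dotp (f (bproj (z a))) (bvect (z a)) : K) @ tails le -->
    (dotp (bvect l) (bvect l) : K).
  apply/cvgrPdist_lt => e e0; have /cvgrPdist_lt/(_ e e0) := dl.
  apply: filterS => a dz; rewrite dotpC [dotp (f _) _]dotpC.
  by rewrite -scalar_conjB norm_scalar_conj.
have : (fun a => `|bvect (z a) - f (bproj (z a))| ^+ 2 : K) @ tails le -->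
    (0 : K).
  under eq_fun do rewrite sqr_normB.
  have -> : 0 = `|bvect l| ^+ 2 + `|bvect l| ^+ 2
      - (dotp (bvect l) (bvect l) + dotp (bvect l) (bvect l)) :> K.
    by rewrite dotp_norm subrr.
  by apply: cvgB; apply: cvgD => //; apply: cvgM.
move=> /cvgr0Pnorm_lt sq; apply/cvgr0Pnorm_lt => e e0.
(* Bounding the squares by [e ^+ 2] bounds the norms by [e]. *)
have e20 : 0 < e ^+ 2 by rewrite exprn_gt0.
apply: filterS (sq _ e20) => a.
by rewrite normrX normr_id ltr_pXn2r // nnegrE ?normr_ge0 ?ltW.
Qed.

End Nets.

End Bundle.

Theorem proposition4p8 (R : realType) (k : scalar_kind) (X : topologicalType)
    (H : continuous_field R k X) (A : Type) (le : A -> A -> Prop)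
    (dirA : directed le) :
  (forall (zeta : A -> bundle H) (zeta_oo : bundle H),
     weak_cvg le zeta zeta_oo ->
     (fun a => `|bvect (zeta a)| : scalarField R k) @ tails le -->
       (`|bvect zeta_oo| : scalarField R k) ->
     strong_cvg le zeta zeta_oo) /\
  (forall (zeta : A -> bundle H) (zeta_oo : bundle H),
     (bvect zeta_oo = 0 ->
        (fun a => bproj (zeta a)) @ tails le --> bproj zeta_oo) ->
     (forall (xi : forall a, fiber H (bproj (zeta a)))
             (xi_oo : fiber H (bproj zeta_oo)),
        meta_weak_cvg le (fun a => bpoint (xi a)) (bpoint xi_oo) ->
        (fun a => dotp (bvect (zeta a)) (xi a) : scalarField R k) @ tails le -->
          (dotp (bvect zeta_oo) xi_oo : scalarField R k)) ->
     strong_cvg le zeta zeta_oo).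
Proof.
have FF := tails_proper dirA; split=> [z l zl nl|z l pl0 zP].
  have [f Cf fl] := csection_full (bvect l).
  pose u x := dotpr (f x) : {scalar fiber H x}.
  (* The section [f] serves twice: as centre of a weak neighborhood of [l] and, through [u], as the
     functional that defines it. *)
  have near V (e : scalarField R k) : open V -> V (bproj l) -> 0 < e ->
      \forall a \near tails le, V (bproj (z a)) /\
        `|dotp (bvect (z a) - f (bproj (z a))) (f (bproj (z a)))| < e.
    move=> oV Vl e0.
    pose B := [set y : bundle H | V (bproj y) /\
      forall v, [set u] v -> `|v (bproj y) (bvect y - f (bproj y))| < e].
    have near_B : \forall a \near tails le, B (z a).
      apply/zl/nbhs_weak.
        exists V, f, [set u], e; split=> //; first exact: csection_wsection.
        split; [|exact: finite_set1|by exists u].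
        by move=> _ ->; exact: cfunctional_dotp.
      by split=> // v _; rewrite fl subrr linear0 normr0.
    by apply: filterS near_B => a [Va /(_ u erefl)].
  have pl : (fun a => bproj (z a)) @ tails le --> bproj l.
    move=> B; rewrite nbhsE => -[V [oV Vl] VB].
    by apply: filterS (near V 1 oV Vl ltr01) => a [/VB].
  apply: (strong_cvg_dotp dirA Cf fl pl); first exact: cvgM.
  (* The pairing is split as [<z, f> = <z - f, f> + <f, f>]: weak convergence handles the first
     term, continuity along the base points the second. *)
  have d0 : (fun a => dotp (bvect (z a) - f (bproj (z a))) (f (bproj (z a)))
      : scalarField R k) @ tails le --> (0 : scalarField R k).
    apply/cvgr0Pnorm_lt => e e0.
    by apply: filterS (near setT e openT I e0) => a [].
  have fz : (fun a => dotp (f (bproj (z a))) (f (bproj (z a)))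
      : scalarField R k) @ tails le -->
      (dotp (bvect l) (bvect l) : scalarField R k).
    by rewrite -fl; exact: (cvg_continuous_comp (continuous_dotp Cf Cf) pl).
  have -> : (fun a => dotp (bvect (z a)) (f (bproj (z a))) : scalarField R k) =
      (fun a => dotp (bvect (z a) - f (bproj (z a))) (f (bproj (z a)))
        + dotp (f (bproj (z a))) (f (bproj (z a)))).
    by apply/funext => a; rewrite -sesquilinear.linearDl subrK.
  by rewrite -[dotp _ _]add0r; exact: cvgD.
(* Zero nets satisfy [zP] with a zero limit whatever their base points do, hence [pl0]; a nonzero
   limit forces the base points to converge. *)
have pl : (fun a => bproj (z a)) @ tails le --> bproj l.
  have [/pl0//|l0] := eqVneq (bvect l) 0.
  apply: contrapT => npl; move/eqP: l0; apply.
  (* No net over [bproj \o z] converges strongly to a point over [bproj l], so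
     the zero net converges meta weakly to everything there. *)
  have : meta_weak_cvg le (fun a => bpoint (0 : fiber H (bproj (z a))))
      (bpoint (bvect l)).
    move=> eta eta_oo etal; exfalso; apply: npl.
    have [f Cf fl] := csection_full (bvect (bpoint eta_oo)).
    by have /(strong_cvgP dirA _ Cf fl)[] := etal.
  (* With limit [bvect l] for the zero net, [zP] makes the constant 0 converge to [|bvect l| ^+ 2];
     uniqueness of limits gives [bvect l = 0]. *)
  move=> /zP; under eq_fun do rewrite sesquilinear.linear0r.
  rewrite dotp_norm => z0; apply/eqP; rewrite -normr_eq0 -sqrf_eq0; apply/eqP.
  exact: (cvg_unique _ z0 (cvg_cst _)).
have zmeta : meta_weak_cvg le (fun a => bpoint (bvect (z a)))
    (bpoint (bvect l)).
  move=> eta eta_oo etal; apply: zP; exact: strong_meta_weak_cvg.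
have [f Cf fl] := csection_full (bvect l).
have fcvg : strong_cvg le (fun a => bpoint (f (bproj (z a))))
    (bpoint (bvect l)).
  apply/(@strong_cvgP _ _ _ _ _ _ dirA f _ (bpoint (bvect l)) Cf fl).
  split=> //=.
  under eq_fun do rewrite subrr normr0; exact: cvg_cst.
(* For the norms, [zP] is applied to [z] itself, admissible by [zmeta]; for the pairing, to [f]
   along the base points. *)
apply: (strong_cvg_dotp dirA Cf fl pl).
  by under eq_fun do rewrite -dotp_norm; rewrite -dotp_norm; exact: zP.
by apply: zP; exact: strong_meta_weak_cvg.
Qed.
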